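(* Let $\sigma\ge n^{\Omega(1)}$. Any algorithm that computes all closed repeats in strings of length $n$ over a general ordered alphabet of size $\Theta(\sigma)$ spends $\Omega(n\log n)$ time on at least one input string of length $n$ that contains $O(n)$ closed repeats.
   Context: General ordered alphabet model: the alphabet is totally ordered and the only operation available on letters is a comparison determining their relative order, costing $O(1)$ time. For a string $s$ of length $n$, $s[i\,..\,j]=s[i]\cdots s[j]$. A non-empty substring $s[i\,..\,j]$ is a closed repeat if it has an occurrence $s[i'\,..\,j']=s[i\,..\,j]$ with $i'>i$ such that $s[i\,..\,j]$ does not occur at positions $i+1,\dots,i'-1$, and both (either $j'=n$ or $s[j+1]\ne s[j'+1]$) and (either $i=1$ or $s[i-1]\ne s[i'-1]$) hold; closed repeats at different positions are counted separately. Computing all closed repeats means outputting all pairs $(i,j)$ such that $s[i\,..\,j]$ is a closed repeat. *)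

(* Defs.v *)
From mathcomp Require Import all_boot all_order.

Set Implicit Arguments.
Unset Strict Implicit.
Unset Printing Implicit Defensive.

Import Order.TTheory.

(* Positions in a string of length n are 0-based, i.e. elements of 'I_n. *)

Section ClosedRepeats.
Variables (T : eqType) (n : nat).
Implicit Types s : n.-tuple T.

(* s[i .. j], both ends included; cut off at the end of s when n <= j. *)
Definition substr s (i j : nat) : seq T := take (j - i).+1 (drop i s).

(* When i <= j < n the equality forces the occurrence to fit in s, since a
   substring cut off at the end of s is shorter than s[i .. j]. *)
Definition occurs_at s (i j k : nat) : bool :=
  substr s k (k + (j - i)) == substr s i j.

Definition closed_repeat s (i j : 'I_n) : bool :=
  (i <= j) &&
  [exists i' : 'I_n, exists j' : 'I_n,
    [&& i < i',
        j' == i' + (j - i) :> nat,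
        substr s i' j' == substr s i j,
        [forall k : 'I_n, (i < k < i') ==> ~~ occurs_at s i j k],
        (j'.+1 == n) || (onth s j.+1 != onth s j'.+1) &
        (i == 0 :> nat) || (onth s i.-1 != onth s i'.-1)]].

Definition closed_repeats s : {set 'I_n * 'I_n} :=
  [set p | closed_repeat s p.1 p.2].

End ClosedRepeats.

(* An algorithm for inputs of length n in the general ordered alphabet model,
   unfolded into the tree of its possible executions. The only access to the
   input is a three-way comparison of the letters at two positions. Everything
   an algorithm does between comparisons is determined by the outcomes of the
   earlier ones, so a step of computation that neither compares letters nor
   outputs a pair matters only through the time it takes: it is a [Work] node.
   The type does not mention the alphabet. *)
Inductive algorithm (n : nat) : Type :=
| Halt
| Compare (i j : 'I_n) (if_lt if_eq if_gt : algorithm n)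
| Emit (p : 'I_n * 'I_n) (next : algorithm n)
| Work (next : algorithm n).

Section Execution.
Variables (d : Order.disp_t) (T : orderType d) (n : nat).
Implicit Types (A : algorithm n) (s : n.-tuple T).

Definition branch s (i j : 'I_n) X (if_lt if_eq if_gt : X) : X :=
  if (tnth s i < tnth s j)%O then if_lt
  else if tnth s i == tnth s j then if_eq else if_gt.

Fixpoint output A s : seq ('I_n * 'I_n) :=
  match A with
  | Halt => [::]
  | Compare i j B C D =>
      branch s i j (output B s) (output C s) (output D s)
  | Emit p B => p :: output B s
  | Work B => output B s
  end.

Fixpoint time A s : nat :=
  match A with
  | Halt => 0
  | Compare i j B C D => (branch s i j (time B s) (time C s) (time D s)).+1
  | Emit _ B => (time B s).+1
  | Work B => (time B s).+1
  end.

End Execution.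

(* Correctness on every string of length n over T; the order in which the pairs
   are output, and repetitions among them, are left free. *)
Definition computes_closed_repeats d (T : orderType d) n (A : algorithm n) :=
  forall s : n.-tuple T, output A s =i closed_repeats s.

(* Main.v *)
(* Fix k > 4 / eps, so that m ~ n^(1/k) letters are few enough for pairs of
   letters to fit in the alphabet. A hard string is a sequence of blocks of
   constant length k + 2: the base 2m+1 digits of the block number make all long
   factors distinct, so that there are O(n) closed repeats, and one more letter
   is alternately free and taken from a cyclic list of all m letters. Equal
   letters in that slot recur within 2m blocks, between different neighbours, so
   each recurrence is a closed repeat of length one. If two hard strings follow
   the same execution, so does the string of pairs of their letters, hence all
   three have the same closed repeats; this forces their equality patterns, and
   with the listed letters the strings themselves, to coincide. Thus the
   m^(n / (2 (k + 2))) hard strings have distinct executions, and one of them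
   takes time at least the base-3 logarithm of their number. *)
Require Import Defs.
From mathcomp Require Import all_boot all_order all_algebra zify ring lra.
From mathcomp Require Import all_classical all_reals all_analysis.

Set Implicit Arguments.
Unset Strict Implicit.
Unset Printing Implicit Defensive.
Import Order.TTheory GRing.Theory Num.Theory.
Import numFieldNormedType.Exports.

(** * Closed repeats *)

Lemma onth_substr (T : eqType) n (s : n.-tuple T) i j e :
  e <= j - i -> onth (substr s i j) e = onth s (i + e).
Proof.
move=> le_e; rewrite /substr !onthE map_take map_drop nth_take ?ltnS //.
by rewrite nth_drop.
Qed.

Lemma closed_repeat_recurs (T : eqType) n (s : n.-tuple T) (i j : 'I_n) :
  closed_repeat s i j ->
  exists i', [/\ i < i', i' + (j - i) < n &
    forall e, e <= j - i -> onth s (i' + e) = onth s (i + e)].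
Proof.
case/andP=> le_ij /existsP[i' /existsP[j' /and5P[lt_ii' /eqP def_j' /eqP eq_s _ _]]].
exists i'; split=> // [|e le_e]; first by rewrite -def_j'.
rewrite -(@onth_substr _ _ s i j) // -eq_s onth_substr //.
by rewrite def_j' addKn.
Qed.

Lemma onth_tnth (T : eqType) n (s : n.-tuple T) (i : 'I_n) :
  onth s i = Some (tnth s i).
Proof.
by rewrite onthE (nth_map (tnth s i)) ?size_tuple // -tnth_nth.
Qed.

Lemma closed_repeat_letter_recurs (T : eqType) n (s : n.-tuple T) (i : 'I_n) :
  closed_repeat s i i -> exists2 i' : 'I_n, i < i' & tnth s i' = tnth s i.
Proof.
case/closed_repeat_recurs=> i' [lt_ii' lt_i'n /(_ 0)].
rewrite subnn addn0 in lt_i'n; rewrite !addn0 => /(_ isT).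
rewrite -[i']/(val (Ordinal lt_i'n)) !onth_tnth => -[eq_s].
by exists (Ordinal lt_i'n).
Qed.

Lemma closed_repeat_letter (T : eqType) n (s : n.-tuple T) (i i' : 'I_n) :
  i < i' -> tnth s i' = tnth s i ->
  (forall k : 'I_n, i < k < i' -> tnth s k != tnth s i) ->
  (i'.+1 < n -> onth s i.+1 != onth s i'.+1) ->
  (0 < i -> onth s i.-1 != onth s i'.-1) ->
  closed_repeat s i i.
Proof.
move=> lt_ii' eq_s between right_diff left_diff.
have substr1 (k : 'I_n) : substr s k k = [:: tnth s k].
  rewrite /substr subnn (drop_nth (tnth s k)) ?size_tuple // -tnth_nth.
  by rewrite /= take0.
rewrite /closed_repeat leqnn; apply/existsP; exists i'; apply/existsP; exists i'.
rewrite subnn addn0 lt_ii' eqxx !substr1 eq_s eqxx /=; apply/and3P; split.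
- apply/forallP=> k; apply/implyP=> lt_k.
  by rewrite /occurs_at subnn addn0 !substr1 eqseq_cons andbT between.
- have := ltn_ord i'; rewrite leq_eqVlt => /orP[-> // | /right_diff ->].
  by rewrite orbT.
- by case: posnP left_diff => //= i_gt0 ->.
Qed.

(** A repeat is determined by its start and by [j - i], which takes at most [L] values. *)
Lemma card_closed_repeats_le (T : eqType) n (s : n.-tuple T) L :
  (forall i j : 'I_n, closed_repeat s i j -> j < i + L) ->
  #|closed_repeats s| <= L * n.
Proof.
case: n s => [s _ | n s short].
  by rewrite muln0 leqn0; apply/eqP; apply: eq_card0 => -[[]].
case: L short => [short | L short].
  rewrite mul0n leqn0; apply/eqP; apply: eq_card0 => -[i j].
  rewrite inE; apply/negP => /= cr; have := short i j cr.
  by have /andP[] := cr; lia.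
pose g (p : 'I_n.+1 * 'I_n.+1) : 'I_L.+1 * 'I_n.+1 := (inord (p.2 - p.1), p.1).
have g_inj : {in closed_repeats s &, injective g}.
  move=> [i j] [i' j']; rewrite !inE /= => cr cr' [/(congr1 val) /= + eq_i].
  have := short _ _ cr; have := short _ _ cr'.
  have /andP[+ _] := cr; have /andP[+ _] := cr'.
  rewrite -eq_i => ? ? ? ?; rewrite !inordK; try lia.
  by move=> ?; congr (_, _); apply: val_inj => /=; lia.
by rewrite -(card_in_imset g_inj) (leq_trans (max_card _)) // card_prod !card_ord.
Qed.

(** * Executions *)

Definition outcome d (T : orderType d) n (s : n.-tuple T) i j : nat :=
  branch s i j 0 1 2.

Lemma outcome_lt3 d (T : orderType d) n (s : n.-tuple T) i j : outcome s i j < 3.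
Proof. by rewrite /outcome /branch; do 2?case: ifP. Qed.

Lemma branchE d (T : orderType d) n (s : n.-tuple T) i j X (x y z : X) :
  branch s i j x y z = nth x [:: x; y; z] (outcome s i j).
Proof. by rewrite /outcome /branch; do 2?case: ifP. Qed.

(* The outcomes of the comparisons made on input s, as base-3 digits with the
   first comparison in the lowest place. *)
Fixpoint trace d (T : orderType d) n (A : algorithm n) (s : n.-tuple T) : nat :=
  match A with
  | Halt => 0
  | Compare i j B C D =>
      outcome s i j + branch s i j (trace B s) (trace C s) (trace D s) * 3
  | Emit _ B => trace B s
  | Work B => trace B s
  end.

(** Each digit is paid for by the unit cost of a comparison; [Emit] and [Work] cost time without
    adding a digit. *)
Lemma trace_lt d (T : orderType d) n (A : algorithm n) (s : n.-tuple T) :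
  trace A s < 3 ^ time A s.
Proof.
elim: A => //= [i j B IHB C IHC D IHD|_ B IHB|B IHB].
- have := outcome_lt3 s i j; rewrite !branchE.
  by case: (outcome s i j) => [|[|[|]]] //= _; rewrite expnS; lia.
- by rewrite (leq_trans IHB) // leq_exp2l.
- by rewrite (leq_trans IHB) // leq_exp2l.
Qed.

(** Induction down the tree: the lowest digit of the equal traces shows that [s] and [s'] branch
    alike, so [t] follows them, and the higher digits are the traces in that subtree. *)
Lemma eq_trace_output d (T : orderType d) n (A : algorithm n) (s s' t : n.-tuple T) :
  (forall i j, outcome s i j = outcome s' i j -> outcome t i j = outcome s i j) ->
  trace A s = trace A s' -> output A t = output A s.
Proof.
move=> st; elim: A => //= [i j B IHB C IHC D IHD|_ B IHB /IHB -> //].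
move=> eq_tr; have eq_o : outcome s i j = outcome s' i j.
  have := congr1 (modn^~ 3) eq_tr.
  by rewrite !(addnC (outcome _ _ _)) !modnMDl !modn_small ?outcome_lt3.
move: eq_tr; rewrite !branchE (st _ _ eq_o) -eq_o => /addnI/eqP.
rewrite eqn_mul2r /= => /eqP; have := outcome_lt3 s i j.
by case: (outcome s i j) => [|[|[|]]] //= _; auto.
Qed.

(* Following recurrences in t from i leads to a position whose letter does not
   recur in t, hence not in s either: it is the last occurrence in s of the
   letter of i, and the same position is reached from j. *)
Lemma last_occurrences (T : eqType) n (s t : n.-tuple T) (P : pred 'I_n) :
  (forall i j, tnth s i = tnth s j -> P i -> P j) ->
  (forall i i' : 'I_n, P i -> i < i' -> tnth s i' = tnth s i -> closed_repeat s i i) ->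
  (forall i j, tnth t i = tnth t j -> tnth s i = tnth s j) ->
  closed_repeats t = closed_repeats s ->
  forall i j, P i -> tnth s i = tnth s j -> tnth t i = tnth t j.
Proof.
move=> Peq single ts eq_cr.
have last (i : 'I_n) : P i -> exists2 k : 'I_n, tnth t k = tnth t i &
    forall k' : 'I_n, k < k' -> tnth s k' <> tnth s k.
  have [m] := ubnP (n - i); elim: m i => // m IHm i le_m Pi.
  have [cr | ncr] := boolP (closed_repeat s i i).
    have /closed_repeat_letter_recurs[i' lt_ii' eq_t]: closed_repeat t i i.
      by move/setP/(_ (i, i)): eq_cr; rewrite !inE cr.
    have [||k eq_tk last_k] := IHm i'; first by have := ltn_ord i'; lia.
      exact: Peq (ts _ _ (esym eq_t)) Pi.
    by exists k; rewrite // eq_tk.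
  by exists i => // k' lt_k eq_s; case/negP: ncr; apply: single lt_k eq_s.
move=> i j Pi eq_s; have [k eq_k last_k] := last i Pi.
have [l eq_l last_l] := last j (Peq _ _ eq_s Pi).
have eq_kl : tnth s k = tnth s l by rewrite (ts _ _ eq_k) (ts _ _ eq_l).
have [lt_kl | lt_lk | /val_inj e] := ltngtP k l; last by rewrite -eq_k -eq_l e.
  by case: (last_k _ lt_kl).
by case: (last_l _ lt_lk).
Qed.

(** * The hard strings *)

Definition digit M q l := q %/ M ^ l %% M.

Lemma digits_inj M k q q' : 0 < M -> q < M ^ k -> q' < M ^ k ->
  (forall l, l < k -> digit M q l = digit M q' l) -> q = q'.
Proof.
move=> M_gt0; elim: k q q' => [|k IHk] q q' lt_q lt_q' eq_d.
  by move: lt_q lt_q'; rewrite expn0; lia.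
have eq_mod : q %% M = q' %% M by have := eq_d 0 isT; rewrite /digit !divn1.
suff eq_div : q %/ M = q' %/ M by rewrite (divn_eq q M) (divn_eq q' M) eq_div eq_mod.
apply: IHk => [||l lt_l]; rewrite ?ltn_divLR -?expnSr //.
by have := eq_d l.+1; rewrite /digit expnS !divnMA; apply.
Qed.

(* The position p lies in block p %/ k.+2. In block q, slot 1 holds the free
   letter w (q %/ 2) if q is odd and the listed letter (q %/ 2) mod m if q is
   even; the other slots hold base 2m+1 digits of q, the lowest one on both
   sides of slot 1. *)
Definition content k m (w : nat -> nat) p : nat :=
  let q := p %/ k.+2 in
  if p %% k.+2 == 1 then if odd q then w q./2 else q./2 %% m
  else digit (2 * m).+1 q (p %% k.+2 - 2).

(** The slot number is the leading part, so that letters in different slots never coincide. *)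
Definition letter k m w p : nat := p %% k.+2 * (2 * m).+1 + content k m w p.

Lemma content_lt k m w p : 0 < m -> (forall h, w h < m) ->
  content k m w p < (2 * m).+1.
Proof.
move=> m_gt0 w_lt; rewrite /content; case: ifP => _; last by rewrite ltn_pmod.
case: ifP => _; first by have := w_lt (p %/ k.+2)./2; lia.
by have := ltn_pmod (p %/ k.+2)./2 m_gt0; lia.
Qed.

Lemma letter_lt k m w p : 0 < m -> (forall h, w h < m) ->
  letter k m w p < k.+2 * (2 * m).+1.
Proof.
move=> m_gt0 w_lt; have := content_lt k p m_gt0 w_lt.
have : p %% k.+2 < k.+2 by rewrite ltn_pmod.
by rewrite /letter; nia.
Qed.

Lemma letter_inj k m w p p' : 0 < m -> (forall h, w h < m) ->
  letter k m w p = letter k m w p' ->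
  p %% k.+2 = p' %% k.+2 /\ content k m w p = content k m w p'.
Proof.
move=> m_gt0 w_lt; have lt_p := content_lt k p m_gt0 w_lt.
have lt_p' := content_lt k p' m_gt0 w_lt; rewrite /letter => eq_pp'; split.
  by have := congr1 (divn^~ (2 * m).+1) eq_pp'; rewrite !divnMDl // !divn_small // !addn0.
by have := congr1 (modn^~ (2 * m).+1) eq_pp'; rewrite !modnMDl !modn_small.
Qed.

Lemma content_slot k m w q c : c < k.+2 ->
  content k m w (q * k.+2 + c) =
  if c == 1 then if odd q then w q./2 else q./2 %% m
  else digit (2 * m).+1 q (c - 2).
Proof.
by move=> lt_c; rewrite /content divnMDl // modnMDl modn_small // divn_small // addn0.
Qed.

(** Two block lengths always contain a whole block, and its digits determine its number. Letters
    reveal their slots, so both windows meet a block boundary at the same offset [e]. *)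
Lemma letter_factor_inj k m w p p' : 0 < m -> (forall h, w h < m) ->
  p < (2 * m).+1 ^ k -> p' < (2 * m).+1 ^ k ->
  (forall e, e < 2 * k.+2 -> letter k m w (p + e) = letter k m w (p' + e)) ->
  p = p'.
Proof.
move=> m_gt0 w_lt lt_p lt_p' eq_l.
have [e lt_e /eqP mod_e] : exists2 e, e < k.+2 & (p + e) %% k.+2 == 0.
  case: (posnP (p %% k.+2)) => [mod0 | mod_gt0].
    by exists 0; rewrite // addn0 mod0.
  exists (k.+2 - p %% k.+2); first by lia.
  rewrite {1}(divn_eq p k.+2) -addnA modnMDl subnKC ?modnn //.
  by rewrite ltnW // ltn_pmod.
have [|mod_e' _] := letter_inj m_gt0 w_lt (eq_l e _); first by lia.
have def_p : p + e = (p + e) %/ k.+2 * k.+2 by rewrite {1}(divn_eq (p + e) k.+2); lia.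
have def_p' : p' + e = (p' + e) %/ k.+2 * k.+2.
  by rewrite {1}(divn_eq (p' + e) k.+2); lia.
set q := _ %/ _ in def_p; set q' := _ %/ _ in def_p'.
suff eq_q : q = q' by apply/eqP; rewrite -(eqn_add2r e) def_p def_p' eq_q.
apply: (@digits_inj (2 * m).+1 k) => // [||l lt_l]; [nia | nia |].
have [|_] := letter_inj m_gt0 w_lt (eq_l (e + l.+2) _); first by lia.
by rewrite !addnA def_p def_p' !content_slot //= ?subn2.
Qed.

(** Any [m] consecutive integers form a complete residue system, so every letter of slot 1 is listed
    among any [m] consecutive even blocks. *)
Lemma listed_in_window m a v : v < m -> exists h, [/\ a <= h, h < a + m & h %% m = v].
Proof.
move=> lt_v; have m_gt0 : 0 < m by lia.
have := ltn_pmod a m_gt0; have := divn_eq a m; set b := _ %/ _ => def_a lt_a.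
have [le_v | lt_v'] := leqP (a %% m) v.
  by exists (b * m + v); rewrite modnMDl modn_small //; split=> //; lia.
by exists (b.+1 * m + v); rewrite modnMDl modn_small //; split=> //; lia.
Qed.

(** * Realisation over an ordered alphabet *)

(** The increasing enumeration of [T]; [inord] gives a default value beyond the last index, hence
    the restricted domain. *)
Lemma nat_order_embedding d (T : finOrderType d) : 0 < #|T| ->
  exists emb : nat -> T,
    {in [pred x | x < #|T|] &, {mono emb : x y / (x <= y)%O}}.
Proof.
move=> T_gt0; have eqN : #|T|.-1.+1 = #|T| by rewrite prednK.
exists (fun x => Order.enum_val (cast_ord eqN (inord x))) => x y.
rewrite !inE => lt_x lt_y; rewrite Order.le_enum_val; last exact: le_total.
by rewrite leEord /= !inordK // eqN.
Qed.

Definition realise d (T : orderType d) (emb : nat -> T) n (f : nat -> nat) :=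
  [tuple emb (f i) | i < n].

Lemma outcome_realise d (T : finOrderType d) (emb : nat -> T) n f (i j : 'I_n) :
  {in [pred x | x < #|T|] &, {mono emb : x y / (x <= y)%O}} ->
  (forall p, f p < #|T|) ->
  outcome (realise emb n f) i j =
  if f i < f j then 0 else if f i == f j then 1 else 2.
Proof.
move=> emb_mono f_lt; rewrite /outcome /branch !tnth_mktuple.
rewrite (leW_mono_in emb_mono) ?inE //.
by rewrite (inj_in_eq (inc_inj_in emb_mono)) ?inE.
Qed.

(** For remainders below [K], [a * K + b] encodes the pair of [a] and [b], and the order of the
    codes is lexicographic. *)
Lemma lex_ltn K a b a' b' : b < K -> b' < K ->
  (a * K + b < a' * K + b') = (a < a') || (a == a') && (b < b').
Proof.
move=> lt_b lt_b'; have [lt_a | lt_a' | ->] /= := ltngtP a a'; [nia | nia |].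
by rewrite ltn_add2l.
Qed.

Lemma lex_eqn K a b a' b' : b < K -> b' < K ->
  (a * K + b == a' * K + b') = (a == a') && (b == b').
Proof.
move=> lt_b lt_b'; have [lt_a | lt_a' | ->] /= := ltngtP a a'; [nia | nia |].
by rewrite eqn_add2l.
Qed.

(** * Closed repeats and executions of the hard strings *)

Section HardStrings.
Variables (d : Order.disp_t) (T : finOrderType d) (n k m : nat) (emb : nat -> T).
Hypothesis k_gt0 : 0 < k.
Hypothesis m_gt0 : 0 < m.
Hypothesis n_le : n <= (2 * m).+1 ^ k.
Hypothesis T_large : (k.+2 * (2 * m).+1) ^ 2 <= #|T|.
Hypothesis emb_mono : {in [pred x | x < #|T|] &, {mono emb : x y / (x <= y)%O}}.

Let emb_inj x y : x < #|T| -> y < #|T| -> emb x = emb y -> x = y.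
Proof. by move=> lt_x lt_y; apply: (inc_inj_in emb_mono); rewrite inE. Qed.

Definition hard_string (w : nat -> nat) := realise emb n (letter k m w).

Let letter_ltT w p : (forall h, w h < m) -> letter k m w p < #|T|.
Proof. by move=> w_lt; have := letter_lt k p m_gt0 w_lt; move: T_large; nia. Qed.

Lemma hard_string_eq w (i j : 'I_n) : (forall h, w h < m) ->
  tnth (hard_string w) i = tnth (hard_string w) j ->
  letter k m w i = letter k m w j.
Proof. by rewrite !tnth_mktuple => w_lt; apply: emb_inj; apply: letter_ltT. Qed.

Let onth_eq w p p' : (forall h, w h < m) -> p < n -> p' < n ->
  onth (hard_string w) p = onth (hard_string w) p' ->
  letter k m w p = letter k m w p'.
Proof.
move=> w_lt lt_p lt_p'.
rewrite -[p]/(val (Ordinal lt_p)) -[p']/(val (Ordinal lt_p')) !onth_tnth => -[].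
exact: hard_string_eq.
Qed.

(** The two occurrences of a longer repeat would agree on two block lengths, and [letter_factor_inj]
    would make them start at the same position. *)
Lemma card_closed_repeats_hard_string w : (forall h, w h < m) ->
  #|closed_repeats (hard_string w)| <= 2 * k.+2 * n.
Proof.
move=> w_lt; apply: card_closed_repeats_le => i j cr.
rewrite ltnNge; apply/negP => le_j.
have [i' [lt_ii' lt_i'n eq_s]] := closed_repeat_recurs cr.
have lt_jn := ltn_ord j.
suff : i = i' :> nat by lia.
apply: (@letter_factor_inj k m w) => // [||e lt_e]; try lia.
by apply: onth_eq; rewrite ?eq_s //; lia.
Qed.

Lemma closed_repeat_hard_string w (i i' : 'I_n) : (forall h, w h < m) ->
  i %% k.+2 = 1 -> i < i' -> tnth (hard_string w) i' = tnth (hard_string w) i ->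
  closed_repeat (hard_string w) i i.
Proof.
set s := hard_string w => w_lt mod_i lt_ii' /eqP eq_i.
have : (i < i') && (tnth s i' == tnth s i) by rewrite lt_ii'.
(* Let [j] be the nearest later occurrence of the letter at [i]. *)
case/(@arg_minnP _ i' (fun j => (i < j) && (tnth s j == tnth s i)) val).
move=> j /andP[lt_ij /eqP eq_s] j_min {i' lt_ii' eq_i}.
have [mod_j eq_c] := letter_inj m_gt0 w_lt (hard_string_eq w_lt eq_s).
have def_i := divn_eq i k.+2; have def_j := divn_eq j k.+2.
rewrite mod_j mod_i in def_j; rewrite mod_i in def_i.
move: (i %/ _) (j %/ _) def_i def_j => q q' def_i def_j.
have lt_qq' : q < q' by nia.
have lt_jn := ltn_ord j.
have le_q' : q' <= q + 2 * m.
  rewrite leqNgt; apply/negP => far.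
  (* Even blocks [2 * h] with [h] from [q./2.+1] on come after block [q]; [m] of them lie before
     [q'], and one lists the letter, against the choice of [j]. *)
  have [|h [le_h lt_h mod_h]] := @listed_in_window m q./2.+1 (content k m w i).
    by rewrite def_i content_slot //=; case: ifP; rewrite ?ltn_pmod.
  have [lt_qh lt_hq'] : q < 2 * h /\ 2 * h < q' by clear -far le_h lt_h; lia.
  have lt_ih : i < 2 * h * k.+2 + 1 by rewrite def_i ltn_add2r ltn_mul2r.
  have lt_hj : 2 * h * k.+2 + 1 < j by rewrite def_j ltn_add2r ltn_mul2r.
  have lt_hn := ltn_trans lt_hj lt_jn.
  have := j_min (Ordinal lt_hn); rewrite {1}/s !tnth_mktuple /=.
  have -> : letter k m w (2 * h * k.+2 + 1) = letter k m w i.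
    rewrite /letter mod_i modnMDl modn_small // content_slot //=.
    by rewrite (mul2n h) odd_double doubleK mod_h.
  by rewrite eqxx andbT lt_ih => /(_ isT); rewrite leqNgt lt_hj.
(* The block numbers differ by at least 1 and at most [2 * m], so they are not congruent modulo
   [(2 * m).+1]. *)
have digit0_diff : digit (2 * m).+1 q 0 <> digit (2 * m).+1 q' 0.
  rewrite /digit !divn1 => /eqP; rewrite eq_sym eqn_mod_dvd ?(ltnW lt_qq') //.
  by move/dvdn_leq; clear -lt_qq' le_q'; lia.
(* Both neighbours of slot 1 hold digit 0: slot 2 directly, slot 0 because [0 - 2] is truncated to
   0. *)
apply: (@closed_repeat_letter _ _ s i j) => // [l /andP[lt_il lt_lj] | lt_j1 | _].
- by apply/negP => eq_l; have := j_min l; rewrite lt_il eq_l => /(_ isT); rewrite leqNgt lt_lj.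
- have lt_i1 := leq_ltn_trans lt_ij lt_jn.
  apply/eqP => /(onth_eq w_lt lt_i1 lt_j1)/(letter_inj m_gt0 w_lt)[_].
  by rewrite def_i def_j -!addnS !content_slot.
- have lt_pred (l : 'I_n) : l.-1 < n := leq_ltn_trans (leq_pred l) (ltn_ord l).
  apply/eqP => /(onth_eq w_lt (lt_pred i) (lt_pred j))/(letter_inj m_gt0 w_lt)[_].
  by rewrite def_i def_j !addn1 /= -[q * _]addn0 -[q' * _]addn0 !content_slot.
Qed.

(* The pairs of corresponding letters, ordered lexicographically, form a string
   that no execution common to both hard strings tells apart from them. *)
Lemma eq_trace_hard_string (A : algorithm n) w w' : computes_closed_repeats T A ->
  (forall h, w h < m) -> (forall h, w' h < m) ->
  trace A (hard_string w) = trace A (hard_string w') ->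
  forall i j : 'I_n, i %% k.+2 = 1 ->
  letter k m w i = letter k m w j -> letter k m w' i = letter k m w' j.
Proof.
move=> A_ok w_lt w'_lt eq_tr i j mod_i eq_l.
pose K := k.+2 * (2 * m).+1.
have lt_K p : letter k m w p < K by apply: letter_lt.
have lt_K' p : letter k m w' p < K by apply: letter_lt.
pose f p := letter k m w p * K + letter k m w' p.
have f_lt p : f p < #|T|.
  apply: leq_trans T_large; rewrite -/K /f; move: (lt_K p) (lt_K' p); clear; nia.
pose t := realise emb n f.
have ts (i1 i2 : 'I_n) : tnth t i1 = tnth t i2 ->
    letter k m w i1 = letter k m w i2 /\ letter k m w' i1 = letter k m w' i2.
  rewrite !tnth_mktuple => /(emb_inj (f_lt _) (f_lt _))/eqP.
  by rewrite /f lex_eqn // => /andP[/eqP ? /eqP ?].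
have eq_out : output A t =i output A (hard_string w).
  move=> p; rewrite (@eq_trace_output _ _ _ A (hard_string w) (hard_string w')) //.
  move=> i1 i2; rewrite !outcome_realise // => [|p'|p']; try exact: letter_ltT.
  (* If both components compare alike, so do the pairs. *)
  rewrite /f lex_ltn // lex_eqn //.
  by case: (ltngtP (letter k m w i1)); case: (ltngtP (letter k m w' i1)).
suff /ts[] : tnth t i = tnth t j by [].
have := @last_occurrences _ n (hard_string w) t (fun i => i %% k.+2 == 1).
apply=> [i1 i2 /(hard_string_eq w_lt)/(letter_inj m_gt0 w_lt)[<-] // | | | | |].
- by move=> i1 i2 /eqP; apply: closed_repeat_hard_string.
- by move=> i1 i2 /ts[eq_12 _]; rewrite !tnth_mktuple eq_12.
- by apply/setP => p; rewrite -!A_ok eq_out.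
- exact/eqP.
- by rewrite !tnth_mktuple eq_l.
Qed.

End HardStrings.

(** There is one free letter per two blocks, and distinct choices of these letters give distinct
    traces, all below 3 to the power of the largest running time. *)
Lemma hard_input d (T : finOrderType d) n k m (A : algorithm n) :
  0 < k -> 0 < m -> n <= (2 * m).+1 ^ k -> 2 * m * k.+2 <= n ->
  (k.+2 * (2 * m).+1) ^ 2 <= #|T| -> computes_closed_repeats T A ->
  exists s : n.-tuple T, #|closed_repeats s| <= 2 * k.+2 * n /\
    m ^ (n %/ (2 * k.+2)) <= 3 ^ time A s.
Proof.
move=> k_gt0 m_gt0 n_le n_ge T_large A_ok.
have [|emb emb_mono] := @nat_order_embedding _ T.
  by rewrite (leq_trans _ T_large) // expn_gt0 muln_gt0.
have n_gt0 : 0 < n %/ (2 * k.+2) by rewrite divn_gt0 //; move: m_gt0 n_ge; clear; nia.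
(* The successor form makes [inord] available for indexing the free letters. *)
rewrite -(prednK n_gt0); set f := _.-1.
have f_le : f.+1 * (2 * k.+2) <= n by rewrite prednK // leq_divM.
pose w (W : {ffun 'I_f.+1 -> 'I_m}) h : nat := W (inord h).
have w_lt W h : w W h < m by apply: ltn_ord.
pose s W : n.-tuple T := hard_string n k m emb (w W).
have trace_inj : injective (fun W => trace A (s W)).
  move=> W W' eq_tr; apply/ffunP => h; have lt_h := ltn_ord h.
  have lt_Wh := ltn_ord (W h).
  (* Slot 1 of the odd block [2 * h + 1] holds the free letter [W h]. *)
  have lt_i : (2 * h).+1 * k.+2 + 1 < n.
    by apply: leq_trans f_le; move: lt_h; clear; nia.
  (* Slot 1 of the even block [2 * W h] lists that same letter; [n_ge] makes room for one full cycle
     of the list. The equality carries over to [W'], where the listed letter is unchanged, so [W' h]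
     is [W h]. *)
  have lt_j : 2 * W h * k.+2 + 1 < n.
    by apply: leq_trans n_ge; move: lt_Wh; clear; nia.
  have letterE V (h' : 'I_f.+1) : letter k m (w V) ((2 * h').+1 * k.+2 + 1) = (2 * m).+1 + V h'.
    rewrite /letter modnMDl modn_small // content_slot //= (mul2n h') odd_double /=.
    by rewrite uphalf_double mul1n /w inord_val.
  have letter2E V (v : 'I_m) : letter k m (w V) (2 * v * k.+2 + 1) = (2 * m).+1 + v.
    rewrite /letter modnMDl modn_small // content_slot //= (mul2n v) odd_double /=.
    by rewrite doubleK mul1n modn_small.
  have := eq_trace_hard_string k_gt0 m_gt0 n_le T_large emb_mono A_ok
    (w_lt W) (w_lt W') eq_tr.
  move=> /(_ (Ordinal lt_i) (Ordinal lt_j)); rewrite /= !letterE !letter2E.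
  rewrite modnMDl modn_small // => /(_ erefl erefl)/addnI eq_h.
  exact/val_inj/esym.
(* The slowest hard string bounds the traces of all of them. *)
have [W _ W_max] := @arg_maxnP _ [ffun=> Ordinal m_gt0] predT (fun W => time A (s W)) isT.
exists (s W); split; first by apply: card_closed_repeats_hard_string (w_lt W).
have lt_trace V : trace A (s V) < 3 ^ time A (s W).
  by rewrite (leq_trans (trace_lt A _)) // leq_exp2l //; apply: W_max.
rewrite -[m]card_ord -[f.+1]card_ord -card_ffun -[3 ^ _]card_ord.
by apply: (@leq_card _ _ (fun V => Ordinal (lt_trace V))) => V V' [/trace_inj].
Qed.

(** * Asymptotics *)

Local Open Scope classical_set_scope.
Local Open Scope ring_scope.

Lemma near_infty_powR_ge (R : realType) (p C : R) : 0 < p -> 0 <= C ->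
  \forall n \near \oo, C <= n%:R `^ p.
Proof.
move=> p_gt0 C_ge0; near=> n.
have <- : (C `^ p^-1) `^ p = C by rewrite -powRrM mulVf ?gt_eqF // powRr1.
apply: ge0_ler_powR; rewrite ?nnegrE ?powR_ge0 ?(ltW p_gt0) //.
by near: n; apply: nbhs_infty_ger.
Unshelve. all: end_near. Qed.

(** The quotient is positive, so rounding it down loses at most a factor of two. *)
Lemma leq_divn_double n D : (0 < D)%N -> (D <= n)%N -> (n <= n %/ D * (2 * D))%N.
Proof.
move=> D_gt0 D_le; have := ltn_ceil n D_gt0.
have : (0 < n %/ D)%N by rewrite divn_gt0.
by move: (n %/ D)%N => q; clear; nia.
Qed.

Lemma root_ceiling (R : realType) (n k : nat) : (0 < n)%N -> (0 < k)%N ->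
  exists m : nat, n%:R `^ k%:R^-1 < m%:R :> R /\
    m%:R <= 2 * n%:R `^ k%:R^-1 :> R.
Proof.
move=> n_gt0 k_gt0; have r_ge1 : 1 <= n%:R `^ k%:R^-1 :> R.
  by rewrite -[leLHS](powRr0 (n%:R : R)); apply: ler_powR; rewrite ?ler1n ?invr_ge0 ?ler0n.
exists (Num.truncn (n%:R `^ k%:R^-1 : R)).+1.
have /andP[le_r lt_r] := truncn_itv (le_trans ler01 r_ge1).
by split=> //; rewrite -natr1; lra.
Qed.

Theorem theorem3 (R : realType) (sigma : nat -> nat) (eps : R)
    (eps_gt0 : 0 < eps)
    (sigma_ge : \forall n \near \oo, n%:R `^ eps <= (sigma n)%:R)
    (a b : R) (a_gt0 : 0 < a) (b_gt0 : 0 < b) :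
  exists c D : R, [/\ 0 < c, 0 < D &
    \forall n \near \oo,
      forall (d : Order.disp_t) (T : finOrderType d),
        a * (sigma n)%:R <= #|T|%:R <= b * (sigma n)%:R ->
      forall A : algorithm n, computes_closed_repeats T A ->
      exists s : n.-tuple T,
        #|closed_repeats s|%:R <= D * n%:R /\
        c * (n%:R * ln n%:R) <= (time A s)%:R].
Proof.
(* Of the four powers of [n^(1/k)] below [sigma n], two provide for pairs of letters and two absorb
   constants. [k > 1] lets the cyclic list fit into the string. *)
have [k k_gt1 k_eps] : exists2 k : nat, (1 < k)%N & k%:R^-1 * 4 <= eps.
  exists (Num.truncn (4 / eps)).+2 => //; set k := _.+2.
  have : 4 / eps < k%:R by rewrite (lt_trans (truncnS_gt _)) // ltr_nat.
  by rewrite ltr_pdivrMr // [_ * 4]mulrC ler_pdivrMr ?ltr0n // [eps * _]mulrC => /ltW.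
have k_gt0 : (0 < k)%N by apply: ltnW.
have k_inv : k%:R^-1 <= 2^-1 :> R by rewrite lef_pV2 ?posrE ?ltr0n // ler_nat.
have kV_gt0 : 0 < k%:R^-1 :> R by rewrite invr_gt0 ltr0n.
have B_gt0 : 0 < k.+2%:R :> R by rewrite ltr0n.
have ln3_gt0 : 0 < ln 3 :> R by rewrite ln_gt0 // ltr1n.
(* In [c], [4 * k.+2] comes from counting free letters, [k] from [ln n = k * ln r], and [ln 3] from
   the base of the traces. *)
exists ((4 * k.+2%:R * k%:R * ln 3)^-1), (2 * k.+2%:R); split.
- by rewrite invr_gt0 !mulr_gt0 // ltr0n.
- by rewrite mulr_gt0.
near=> n => d T /andP[T_ge _] A A_ok.
have n_gt0 : (0 < n)%N by near: n; exact: nbhs_infty_gt.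
have n_ge1 : 1 <= n%:R :> R by rewrite ler1n.
have [m [lt_m le_m]] := @root_ceiling R n k n_gt0 k_gt0.
set r := n%:R `^ k%:R^-1 in lt_m le_m.
have r_ge1 : 1 <= r by rewrite -[leLHS](powRr0 (n%:R : R)); apply: ler_powR => //; apply: ltW.
have rX j : r ^+ j = n%:R `^ (k%:R^-1 * j%:R).
  by rewrite powRrM powR_mulrn // powR_ge0.
have m_gt0 : (0 < m)%N by rewrite -(ltr0n R); lra.
have le_n : (n <= (2 * m).+1 ^ k)%N.
  apply: (@leq_trans (m ^ k)); last by rewrite leq_exp2r // leqW // leq_pmull.
  rewrite -(ler_nat R) natrX.
  have -> : n%:R = r ^+ k by rewrite rX mulVf ?gt_eqF ?ltr0n // powRr1.
  by rewrite lerXn2r ?nnegrE ?ltW //; lra.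
have ge_n : (2 * m * k.+2 <= n)%N.
  rewrite -(ler_nat R) !natrM.
  (* Here [2 * m] is at most [4 * r], and [r] is at most the square root of [n]. *)
  have C_le : 4 * k.+2%:R <= n%:R `^ 2^-1 :> R.
    near: n; apply: near_infty_powR_ge; first by rewrite invr_gt0.
    by rewrite mulr_ge0 // ltW.
  have r_le : r <= n%:R `^ 2^-1 by apply: ler_powR.
  have -> : n%:R = n%:R `^ 2^-1 * n%:R `^ 2^-1 :> R.
    by rewrite -expr2 -powR_mulrn ?powR_ge0 // -powRrM mulVf // powRr1.
  apply: le_trans (ler_pM _ _ r_le C_le); [|lra|lra].
  by nra.
have T_large : ((k.+2 * (2 * m).+1) ^ 2 <= #|T|)%N.
  (* The 25 is the square of the 5 in [2 * m + 1 <= 5 * r]. *)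
  have C_le : 25 * k.+2%:R ^+ 2 / a <= r ^+ 2.
    rewrite rX; near: n; apply: near_infty_powR_ge; first exact: mulr_gt0.
    by rewrite divr_ge0 ?ltW // mulr_gt0 // exprn_gt0.
  have r4_le : r ^+ 4 <= (sigma n)%:R.
    rewrite rX (le_trans (ler_powR n_ge1 k_eps)) //.
    by near: n; exact: sigma_ge.
  rewrite -(ler_nat R) (le_trans _ T_ge) // natrX natrM -[(2 * m).+1%:R]natr1 natrM exprMn.
  apply: le_trans (ler_wpM2l (ltW a_gt0) r4_le).
  have m_le : 2 * m%:R + 1 <= 5 * r by clear -le_m r_ge1; lra.
  have m_ge0 : 0 <= 2 * m%:R + 1 :> R by rewrite addr_ge0 ?mulr_ge0.
  have : (2 * m%:R + 1) ^+ 2 <= (5 * r) ^+ 2.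
    by rewrite lerXn2r ?nnegrE // (le_trans m_ge0).
  move: C_le; rewrite ler_pdivrMr // exprMn.
  have := exprn_gt0 2 B_gt0; have := exprn_ge0 2 (le_trans ler01 r_ge1).
  have -> : r ^+ 4 = r ^+ 2 * r ^+ 2 by rewrite -exprD.
  by move: (r ^+ 2) (_%:R ^+ 2) (_ ^+ 2) => r2 B2 x; clear; nra.
have [s [few slow]] := hard_input k_gt0 m_gt0 le_n ge_n T_large A_ok.
exists s; split; first by rewrite -!natrM ler_nat.
set f := (n %/ _)%N in slow.
have f_ge : n%:R <= f%:R * (4 * k.+2%:R) :> R.
  rewrite -!natrM ler_nat (_ : 4 * k.+2 = 2 * (2 * k.+2))%N; last by rewrite mulnA.
  by rewrite /f leq_divn_double // (leq_trans _ ge_n) // leq_mul2r leq_pmulr.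
have ln_n : ln n%:R = k%:R * ln r.
  by rewrite ln_powR mulrA divff ?mul1r // pnatr_eq0 -lt0n.
have ln_r : ln r <= ln m%:R by rewrite ler_ln ?posrE ?ltr0n ?(ltW lt_m) // (lt_le_trans ltr01).
have ln_r_ge0 : 0 <= ln r by rewrite ln_ge0.
have ln_slow : f%:R * ln m%:R <= (time A s)%:R * ln 3 :> R.
  rewrite ![_%:R * _]mulr_natl -!lnXn ?ltr0n // ler_ln ?posrE ?exprn_gt0 ?ltr0n //.
  by rewrite -!natrX ler_nat.
rewrite mulrC ler_pdivrMr; last by rewrite !mulr_gt0 // ltr0n.
have -> : (time A s)%:R * (4 * k.+2%:R * k%:R * ln 3) =
  4 * k.+2%:R * k%:R * ((time A s)%:R * ln 3) :> R by ring.
have C_ge0 : 0 <= 4 * k.+2%:R * k%:R :> R by rewrite !mulr_ge0 // ltW.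
apply: le_trans (ler_wpM2l C_ge0 ln_slow).
have -> : 4 * k.+2%:R * k%:R * (f%:R * ln m%:R) =
  f%:R * (4 * k.+2%:R) * (k%:R * ln m%:R) :> R by ring.
by rewrite ln_n ler_pM ?mulr_ge0 ?ler_wpM2l.
Unshelve. all: end_near. Qed.
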